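(* Let $X$ be a smooth hypersurface of degree $d\ge 3$ in $\mathbb{P}^N$ and let $L$ be a line in $\mathbb{P}^N$ such that $L\subset X$. Then $X$ has at most two star points on the line $L$.
   Context: The base field is $\mathbb{C}$ and $N\ge 2$. For a smooth point $P$ of a hypersurface $X\subset\mathbb{P}^N$ of degree $d$, $T_P(X)$ denotes the embedded tangent hyperplane of $X$ at $P$ in $\mathbb{P}^N$; $P$ is a star point of $X$ if the scheme $T_P(X)\cap X$ has multiplicity $d$ at $P$ (for $N\ge3$: if it is a cone of degree $d$ with vertex $P$ in $T_P(X)$). *)

(* Defs.v *)
From mathcomp Require Import all_boot all_order all_algebra.
From mathcomp Require Import mpoly complex.
From mathcomp Require Import reals.

Set Implicit Arguments.
Unset Strict Implicit.
Unset Printing Implicit Defensive.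

Import GRing.Theory.
Local Open Scope ring_scope.

(* Points and lines of P^N are the 1- and 2-dimensional subspaces of K^(N+1). *)
Definition projpt (K : fieldType) (N : nat) : Type :=
  {U : {vspace 'rV[K]_N.+1} | \dim U == 1%N}.

Section Hypersurfaces.
Variables (K : fieldType) (N : nat).
Implicit Types (F : {mpoly K[N.+1]}) (P : projpt K N).
Implicit Types (W L : {vspace 'rV[K]_N.+1}).

Definition is_line L : Prop := \dim L = 2.

Definition lies_on P W : bool := (val P <= W)%VS.

(* Homogeneous coordinates of P. Every notion below in which they occur is
   unchanged when they are multiplied by a nonzero scalar. *)
Definition hcoord P : 'rV[K]_N.+1 := vpick (val P).

(* The equation F, up to a nonzero scalar, determines the hypersurface X as a
   scheme. *)
Definition hypersurface (d : nat) F : Prop := F != 0 /\ F \is d.-homog.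

Definition on_hypersurface F P : Prop := F.@[hcoord P 0] = 0.

Definition gradient F P : 'cV[K]_N.+1 := \col_i (F^`M(i)).@[hcoord P 0].

Definition smooth_at F P : Prop := gradient F P != 0.

Definition smooth_hypersurface (d : nat) F : Prop :=
  hypersurface d F /\ forall P, on_hypersurface F P -> smooth_at F P.

Definition contained_in W F : Prop :=
  forall P, lies_on P W -> on_hypersurface F P.

(* Embedded tangent hyperplane at P: the v with
   \sum_i (dF/dX_i)(P) * v_i = 0. *)
Definition tangent_hyperplane F P : {vspace 'rV[K]_N.+1} :=
  lker (linfun (mulmxr (gradient F P) : 'rV[K]_N.+1 -> 'rV[K]_1)).

(* For P in P(W): the equation of the scheme P(W) :&: X in the affine chart
   y |-> [p + \sum_k y_k b_k] of P(W), where p are coordinates of P and the b_k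
   are a basis of a complement of the line P in W. The point P is y = 0. A
   different choice of p and (b_k) changes the equation by a unit and a
   coordinate change of the local ring at P. *)
Definition local_equation F W P : {mpoly K[\dim (W :\: val P)]} :=
  F \mPo [tuple (hcoord P 0 j)%:MP
                + \sum_(k < \dim (W :\: val P))
                    ((vbasis (W :\: val P))`_k 0 j) *: 'X_k | j < N.+1].

(* The multiplicity at the origin of the affine hypersurface f = 0 is m: m is
   the largest power of the maximal ideal (X_k)_k which contains f. It is
   never satisfied by f = 0. *)
Definition multiplicity0 (n : nat) (f : {mpoly K[n]}) (m : nat) : Prop :=
  (forall u, u \in msupp f -> (m <= mdeg u)%N) /\
  (exists2 u, u \in msupp f & mdeg u = m).

Definition section_multiplicity F W P (m : nat) : Prop :=
  multiplicity0 (local_equation F W P) m.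

Definition star_point (d : nat) F P : Prop :=
  [/\ on_hypersurface F P, smooth_at F P
    & section_multiplicity F (tangent_hyperplane F P) P d].

End Hypersurfaces.

(* Main.v *)
Require Import Defs.
From mathcomp Require Import all_boot all_order all_algebra.
From mathcomp Require Import mpoly complex.
From mathcomp Require Import reals.
From mathcomp Require Import ring.

Set Implicit Arguments.
Unset Strict Implicit.
Unset Printing Implicit Defensive.

Import GRing.Theory Num.Theory.
Local Open Scope ring_scope.

(** Write D_v F for the derivative of F in the direction v, and p for
    coordinates of a point P, so that T_P is the space of the v with
    (D_v F)(p) = 0. If P is a star point, then F restricted to T_P does not
    depend on the direction p ([star_point_cone]). Differentiating this along
    v in T_P shows that D_v F, restricted to T_P, does not depend on the
    direction p either ([polar_star]). A line L on X through P lies in T_P, so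
    if p, q are coordinates of two points of L and P is a star point, then
      (D_v F)(x p + y q) = y^(d-1) (D_v F)(q)   for all v in T_P,
    because D_v F is homogeneous of degree d - 1 ([polar_star_line]).

    Two star points P, Q of L have different tangent hyperplanes
    ([star_tangent_nsub]): otherwise all D_v F with v in T_P = T_Q would vanish
    on L, and so would every derivative of F at a zero on L of the form D_w F,
    for a single w outside T_P; such a zero exists because the base field is
    algebraically closed, and X would be singular there.

    Let P0, P1, P2 be three star points of L, with p2 = a p0 + b p1. Choose
    v0 in T_P0 but not in T_P1, and v1 in T_P1 but not in T_P0. With
    m = d - 1, the forms D_v0 F and D_v1 F are nonzero multiples of y^m and
    x^m on L, so some combination v of v0 and v1 has D_v F proportional to
    a^m y^m - b^m x^m. This vanishes at p2, so v lies in T_P2, and D_v F takes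
    the same value at b p1 as at b p1 + p2 = a p0 + 2 b p1. That says
    2^m = 2, which is impossible as m >= 2 ([third_star_point]). *)

(** * Restriction of forms to lines, and directional derivatives *)

Section PolynomialIdentities.
Variable K : numFieldType.

Lemma eq_poly_off0 (p q : {poly K}) :
  (forall x, x != 0 -> p.[x] = q.[x]) -> p = q.
Proof.
move=> eq_pq; apply/eqP; rewrite -subr_eq0; apply/eqP.
set r := p - q; apply: (@roots_geq_poly_eq0 _ r
  [seq i.+1%:R | i <- iota 0 (size r)]).
- apply/allP => _ /mapP[i _ ->].
  by rewrite /root !hornerE eq_pq ?subrr ?pnatr_eq0.
- rewrite map_inj_uniq ?iota_uniq // => i j /eqP.
  by rewrite eqr_nat eqSS => /eqP.
- by rewrite size_map size_iota.
Qed.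

Variable n : nat.
Implicit Types (F G : {mpoly K[n]}) (a b v w x : 'rV[K]_n).

Lemma dhomog_eval_scale e G c x :
  G \is e.-homog -> G.@[(c *: x) 0] = c ^+ e * G.@[x 0].
Proof.
move=> hG; rewrite !mevalE mulr_sumr; apply: eq_big_seq => m mG.
rewrite mulrCA; congr (_ * _).
under eq_bigr do rewrite mxE exprMn.
rewrite big_split /= prodrXr -mdegE.
by have /= -> := dhomog_mf hG mG.
Qed.

Lemma dhomog_mderiv d F i : F \is d.-homog -> F^`M(i) \is d.-1.-homog.
Proof.
move=> hF; apply/dhomogP => m /=; rewrite mcoeff_msupp mcoeff_mderiv => nz.
have mF : (m + U_(i))%MM \in msupp F.
  by rewrite mcoeff_msupp; apply: contraNneq nz => ->; rewrite mul0rn.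
by have /= <- := dhomog_mf hF mF; rewrite mdegD mdeg1 addn1.
Qed.

Definition along a b F : {poly K} :=
  mmap polyC (fun i => (a 0 i)%:P + b 0 i *: 'X) F.

Lemma along_eval a b F t : (along a b F).[t] = F.@[(a + t *: b) 0].
Proof.
rewrite /along /mmap horner_sum mevalE; apply: eq_bigr => m _.
rewrite hornerM hornerC /mmap1 horner_prod; congr (_ * _).
apply: eq_bigr => i _.
by rewrite horner_exp !hornerE !mxE mulrC.
Qed.

Lemma size_along d a b F : F \is d.-homog -> (size (along a b F) <= d.+1)%N.
Proof.
move=> hF; rewrite /along /mmap.
rewrite (leq_trans (size_sum _ _ _)) //.
rewrite big_seq; apply: (big_ind (fun k => k <= d.+1)%N) => //.
  by move=> k l; rewrite geq_max => -> ->.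
move=> m mF; rewrite mul_polyC (leq_trans (size_scale_leq _ _)) //.
have /= <- := dhomog_mf hF mF.
rewrite mdegE /mmap1.
elim/big_ind2: _ => [|p k q l hp hq|i _].
- by rewrite size_poly1.
- rewrite (leq_trans (size_polyMleq _ _)) //.
  move: hp hq; set u := size p; set v := size q; clearbody u v.
  case: u => [|u] hp hq.
    by rewrite add0n (leq_trans (leq_pred _)) ?(leq_trans hq) ?ltnS ?leq_addl.
  by rewrite addSn /= -addnS leq_add.
- rewrite (leq_trans (size_poly_exp_leq _ _)) // ltnS -[leqRHS]mul1n leq_mul //.
  rewrite -subn1 leq_subLR (leq_trans (size_polyD _ _)) // geq_max.
  rewrite (leq_trans (size_polyC_leq1 _)) //.
  by rewrite (leq_trans (size_scale_leq _ _)) ?size_polyX.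
Qed.

(** On the line t |-> t v, the monomial 'X_[m] becomes a multiple of t^(mdeg m). *)
Lemma dvdp_Xn_along e F v :
    (forall m, m \in msupp F -> (e <= mdeg m)%N) ->
  exists h, along 0 v F = h * 'X^e.
Proof.
move=> ordF; rewrite /along /mmap big_seq.
apply: (big_ind (fun p => exists h, p = h * 'X^e)).
- by exists 0; rewrite mul0r.
- by move=> _ _ [h ->] [k ->]; exists (h + k); rewrite mulrDl.
move=> m /ordF le_em; rewrite /mmap1.
under eq_bigr do rewrite mxE add0r exprZn.
rewrite scaler_prod prodrXr -mdegE -(subnK le_em) exprD.
set c := \prod_(i < n) _.
by exists ((F@_m)%:P * (c *: 'X^(mdeg m - e))); rewrite -mulrA scalerAl.
Qed.

(** The first polar of F with respect to v. *)
Definition polar v F : {mpoly K[n]} := \sum_i v 0 i *: F^`M(i).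

Lemma polar_dhomog d v F : F \is d.-homog -> polar v F \is d.-1.-homog.
Proof.
by move=> hF; apply: rpred_sum => i _; apply/dhomogZ/dhomog_mderiv.
Qed.

Lemma polarD v w F : polar (v + w) F = polar v F + polar w F.
Proof.
by rewrite /polar -big_split; apply: eq_bigr => i _; rewrite mxE scalerDl.
Qed.

Lemma polarZ c v F : polar (c *: v) F = c *: polar v F.
Proof.
by rewrite /polar scaler_sumr; apply: eq_bigr => i _; rewrite mxE scalerA.
Qed.

(** The chain rule. Both sides are derivations in F over evaluation at a, so
    it is enough to compare them on the variables. *)
Lemma deriv_along a v F : (along a v F)^`().[0] = (polar v F).@[a 0].
Proof.
pose leib G := (along a v G)^`().[0] = (polar v G).@[a 0].
have eval0 G : (along a v G).[0] = G.@[a 0].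
  by rewrite along_eval scale0r addr0.
have leib1 : leib 1.
  rewrite /leib /along -mpolyC1 mmapC derivC horner0 /polar.
  by rewrite big1 ?meval0 // => i _; rewrite mderivC scaler0.
have leibM G H : leib G -> leib H -> leib (G * H).
  rewrite /leib => lG lH; rewrite /along rmorphM /= -!/(along _ _ _).
  rewrite derivM hornerD !hornerM lG lH !eval0 /polar !raddf_sum /=.
  rewrite mulr_suml mulr_sumr -big_split; apply: eq_bigr => i _.
  by rewrite mderivM !mevalZ mevalD !mevalM /=; ring.
have leibX i : leib 'X_i.
  rewrite /leib /along mmapX mmap1U derivD derivZ derivX derivC !hornerE /polar.
  have subU : (U_(i) - U_(i))%MM = 0%MM :> 'X_{1..n}.
    by apply/mnmP=> j; rewrite !mnmE subnn.
  rewrite raddf_sum (bigD1 i) //= mevalZ mderivX mnm1E eqxx scale1r subU.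
  rewrite mpolyX0 meval1 mulr1 big1 ?addr0 // => j /negPf ji.
  by rewrite mevalZ mderivX mnm1E eq_sym ji scale0r meval0 mulr0.
elim/mpolyind: F => [|c m p _ _ IH].
  rewrite /along mmap0 deriv0 horner0 /polar big1 ?meval0 // => i _.
  by rewrite mderiv0 scaler0.
have leibXm : leib 'X_[m].
  rewrite mpolyXE_id; apply: (big_ind leib) => // i _.
  by elim: (m i) => [|k IHk]; rewrite ?expr0 // exprS; apply: leibM.
rewrite /along mmapD mmapZ /= mul_polyC derivD derivZ hornerD hornerZ.
rewrite -!/(along _ _ _) leibXm IH /polar !raddf_sum mulr_sumr -big_split /=.
apply: eq_bigr => i _; rewrite mderivD mderivZ !mevalZ mevalD mevalZ.
by ring.
Qed.

End PolynomialIdentities.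

(** An identity between values of F on two parallel lines can be
    differentiated. *)
Lemma polar_eq (K : numFieldType) n (F : {mpoly K[n]}) (a a' v : 'rV[K]_n) :
    (forall t, F.@[(a + t *: v) 0] = F.@[(a' + t *: v) 0]) ->
  (polar v F).@[a 0] = (polar v F).@[a' 0].
Proof.
move=> eqF; rewrite -!deriv_along; congr (_^`()).[0].
by apply: eq_poly_off0 => t _; rewrite !along_eval.
Qed.

(** Either G vanishes at b, or its dehomogenization t |-> G(a + t b) has a
    root. The latter cannot be a constant c: G(b + s a) would be c s^e for all
    nonzero s, hence for s = 0, and G(b) would vanish after all. *)
Lemma binary_form_zero (K : numClosedFieldType) n e (G : {mpoly K[n]})
    (a b : 'rV[K]_n) :
    (0 < e)%N -> G \is e.-homog ->
  exists2 xy : K * K, xy != (0, 0) & G.@[(xy.1 *: a + xy.2 *: b) 0] = 0.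
Proof.
move=> e_gt0 hG; have [Gb0|Gb_neq0] := eqVneq G.@[b 0] 0.
  exists (0, 1); first by rewrite xpair_eqE oner_eq0 andbF.
  by rewrite scale0r add0r scale1r.
have [/closed_rootP[t]|] := boolP (size (along a b G) != 1%N).
  rewrite /root along_eval => /eqP Gt0; exists (1, t).
    by rewrite xpair_eqE oner_eq0.
  by rewrite scale1r.
rewrite negbK => /eqP size1.
have /size1_polyC def_c : (size (along a b G) <= 1)%N by rewrite size1.
set c := _`_0 in def_c.
have along_ba : along b a G = c *: 'X^e.
  apply: eq_poly_off0 => s s0; rewrite along_eval hornerZ hornerXn.
  have -> : b + s *: a = s *: (a + s^-1 *: b).
    by rewrite scalerDr scalerA mulfV // scale1r addrC.
  by rewrite (dhomog_eval_scale _ _ hG) -along_eval def_c hornerC mulrC.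
case/negP: Gb_neq0; apply/eqP; have := along_eval b a G 0.
rewrite along_ba scale0r addr0 => <-.
by rewrite hornerZ hornerXn expr0n gtn_eqF // mulr0.
Qed.

(** * Star points and tangent hyperplanes *)

Section StarPoints.
Variables (K : numFieldType) (N : nat).
Implicit Types (F : {mpoly K[N.+1]}) (P : projpt K N) (v w : 'rV[K]_N.+1).

Lemma hcoord_neq0 P : hcoord P != 0.
Proof.
rewrite vpick0; apply: contraTneq (valP P) => ->.
by rewrite dimv0.
Qed.

Lemma projpt_line P : val P = <[hcoord P]>%VS.
Proof.
apply/esym/eqP; rewrite eqEdim -memvE memv_pick dim_vline hcoord_neq0.
by rewrite (eqP (valP P)).
Qed.

Lemma mem_tangent F P v :
  (v \in tangent_hyperplane F P) = ((polar v F).@[hcoord P 0] == 0).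
Proof.
have val_polar :
    v *m gradient F P = \matrix_(_, _) (polar v F).@[hcoord P 0].
  apply/matrixP => i j; rewrite !mxE ord1 /polar raddf_sum /=.
  by apply: eq_bigr => k _; rewrite mxE mevalZ.
rewrite memv_ker lfunE /= val_polar; apply/eqP/eqP => [|eq0].
  by move/matrixP/(_ 0 0); rewrite !mxE.
by apply/matrixP=> i j; rewrite !mxE.
Qed.

Lemma local_equation_eval F W P (y : 'rV[K]_(\dim (W :\: val P)%VS)) :
  (local_equation F W P).@[y 0] =
  F.@[(hcoord P + \sum_k y 0 k *: (vbasis (W :\: val P)%VS)`_k) 0].
Proof.
rewrite comp_mpoly_meval; apply: meval_eq => j.
rewrite tnth_mktuple mevalD mevalC mxE raddf_sum summxE /=; congr (_ + _).
by apply: eq_bigr => k _; rewrite mevalZ mevalXU mxE mulrC.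
Qed.

(** Write w = c p + u with u in the complement of P used by the local equation.
    Multiplicity d makes t^d divide F(p + t u), whose degree in t is at most d;
    thus F(p + t u) = c' t^d, and by homogeneity F(u + t p) = c' for all t. *)
Lemma star_point_cone d F P w s :
    F \is d.-homog -> star_point d F P -> w \in tangent_hyperplane F P ->
  F.@[(w + s *: hcoord P) 0] = F.@[w 0].
Proof.
move=> hF [_ _ [ord_d _]]; set T := tangent_hyperplane F P.
set p := hcoord P; rewrite -{1}(addv_diff_cap T (val P)).
case/memv_addP => u uU [q]; rewrite memv_cap projpt_line => /andP[_].
case/vlineP => c -> ->.
pose y := \row_k coord (vbasis (T :\: val P)%VS) k u.
have along_pu t : (local_equation F T P).@[(t *: y) 0] = F.@[(p + t *: u) 0].
  rewrite local_equation_eval; congr (meval (fun_of_matrix (p + _) 0) F).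
  rewrite [in RHS](coord_vbasis uU) scaler_sumr; apply: eq_bigr => k _.
  by rewrite !mxE scalerA.
have [h def_h] := dvdp_Xn_along y ord_d.
have {}def_h : along p u F = h * 'X^d.
  rewrite -def_h; apply: eq_poly_off0 => t _.
  by rewrite !along_eval add0r along_pu.
have /size1_polyC def_c : (size h <= 1)%N.
  have [->|h0] := eqVneq h 0; first by rewrite size_poly0.
  have := size_along p u hF; rewrite def_h size_mulXn //.
  by rewrite -addn1 leq_add2l.
have along_pu_c : along p u F = h`_0 *: 'X^d.
  by rewrite def_h {1}def_c mul_polyC.
have along_up : along u p F = (h`_0)%:P.
  apply: eq_poly_off0 => t t0; rewrite along_eval hornerC.
  have -> : u + t *: p = t *: (p + t^-1 *: u).
    by rewrite scalerDr scalerA mulfV // scale1r addrC.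
  rewrite (dhomog_eval_scale _ _ hF) -along_eval along_pu_c hornerZ hornerXn.
  by rewrite mulrCA -exprMn mulfV // expr1n mulr1.
by rewrite -addrA -scalerDl -!along_eval along_up !hornerC.
Qed.

Lemma polar_star d F P q v s :
    F \is d.-homog -> star_point d F P ->
    q \in tangent_hyperplane F P -> v \in tangent_hyperplane F P ->
  (polar v F).@[(q + s *: hcoord P) 0] = (polar v F).@[q 0].
Proof.
move=> hF starP qT vT; apply: polar_eq => t.
by rewrite addrAC (star_point_cone _ hF starP) // rpredD ?rpredZ.
Qed.

Lemma exists_projpt v :
  v != 0 -> exists (P : projpt K N) (c : K), c != 0 /\ v = c *: hcoord P.
Proof.
move=> v0; have dim1 : \dim <[v]>%VS == 1%N by rewrite dim_vline v0.
exists (exist _ <[v]>%VS dim1); set P : projpt K N := exist _ _ _.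
have /vlineP[c def_v] : v \in <[hcoord P]>%VS.
  by rewrite -projpt_line memv_line.
exists c; split=> //; apply: contraNneq v0 => c0.
by rewrite def_v c0 scale0r.
Qed.

Lemma contained_eval d F W v :
    (0 < d)%N -> F \is d.-homog -> contained_in W F -> v \in W ->
  F.@[v 0] = 0.
Proof.
move=> d_gt0 hF sWF vW; have [->|/exists_projpt[P [c [c0 def_v]]]] := eqVneq v 0.
  rewrite -(scale0r (0 : 'rV[K]_N.+1)) (dhomog_eval_scale _ _ hF).
  by rewrite expr0n gtn_eqF // mul0r.
have PW : lies_on P W.
  by rewrite /lies_on projpt_line -memvE -[hcoord P](scalerK c0) -def_v memvZ.
by rewrite def_v (dhomog_eval_scale _ _ hF) (sWF P PW) mulr0.
Qed.

(** F vanishes along the line from p towards q, so its derivative at p in the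
    direction q is zero. *)
Lemma contained_sub_tangent d F W P q :
    (0 < d)%N -> F \is d.-homog -> contained_in W F -> lies_on P W -> q \in W ->
  q \in tangent_hyperplane F P.
Proof.
move=> d_gt0 hF sWF PW qW; rewrite mem_tangent -deriv_along.
have -> : along (hcoord P) q F = 0.
  apply: eq_poly_off0 => t _; rewrite along_eval horner0.
  apply: (contained_eval d_gt0 hF sWF).
  by rewrite rpredD ?rpredZ // (subvP PW) // memv_pick.
by rewrite deriv0 horner0.
Qed.

Lemma smooth_polar d F v :
    smooth_hypersurface d F -> v != 0 -> F.@[v 0] = 0 ->
  exists w, (polar w F).@[v 0] != 0.
Proof.
case=> [[_ hF] smF] /exists_projpt[P [c [c0 ->]]].
rewrite (dhomog_eval_scale _ _ hF) => /eqP.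
rewrite mulf_eq0 expf_eq0 (negPf c0) andbF /= => /eqP/smF/matrix0Pn[i [j]].
rewrite mxE => grad_i; exists (delta_mx 0 i).
rewrite (dhomog_eval_scale _ _ (polar_dhomog _ hF)) mulf_neq0 ?expf_neq0 //.
rewrite /polar (bigD1 i) //= mxE !eqxx scale1r big1 ?addr0 // => k /negPf ki.
by rewrite mxE ki andbF scale0r.
Qed.

Lemma hcoord_free P Q x y :
  P != Q -> x *: hcoord P + y *: hcoord Q = 0 -> x = 0 /\ y = 0.
Proof.
move=> neqPQ; have [->|x0] := eqVneq x 0.
  rewrite scale0r add0r => /eqP.
  by rewrite scaler_eq0 (negPf (hcoord_neq0 Q)) orbF => /eqP.
move/eqP; rewrite addr_eq0 => /eqP def_xp; case/negP: neqPQ.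
apply/eqP/val_inj/eqP; rewrite eqEdim (eqP (valP P)) (eqP (valP Q)) leqnn andbT.
rewrite projpt_line -memvE -[hcoord P](scalerK x0) def_xp.
by rewrite memvZ // memvN memvZ // memv_pick.
Qed.

Lemma line_hcoord L P Q v :
    is_line L -> lies_on P L -> lies_on Q L -> P != Q -> v \in L ->
  exists a b, v = a *: hcoord P + b *: hcoord Q.
Proof.
move=> dimL PL QL neqPQ vL.
have sPQL : (val P + val Q <= L)%VS by rewrite subv_add; apply/andP.
have defL : (val P + val Q)%VS = L.
  apply/eqP; rewrite eqEdim sPQL dimL dimv_disjoint_sum.
    by rewrite (eqP (valP P)) (eqP (valP Q)).
  apply/eqP; rewrite -subv0; apply/subvP => u.
  rewrite memv_cap !projpt_line => /andP[/vlineP[x ->] /vlineP[y]].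
  move/eqP; rewrite -subr_eq0 -scaleNr => /eqP/(hcoord_free neqPQ)[-> _].
  by rewrite scale0r mem0v.
move: vL; rewrite -defL !projpt_line => /memv_addP[_ /vlineP[a ->]].
by case=> _ /vlineP[b ->] ->; exists a, b.
Qed.

(** By [polar_star] the term x p does not affect the value; the factor y
    comes out by homogeneity. *)
Lemma polar_star_line d F L P Q v x y :
    (0 < d)%N -> F \is d.-homog -> contained_in L F ->
    star_point d F P -> lies_on P L -> lies_on Q L ->
    v \in tangent_hyperplane F P ->
  (polar v F).@[(x *: hcoord P + y *: hcoord Q) 0]
    = y ^+ d.-1 * (polar v F).@[hcoord Q 0].
Proof.
move=> d_gt0 hF sLF starP PL QL vT; rewrite addrC (polar_star _ hF) //.
  exact: dhomog_eval_scale (polar_dhomog _ hF).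
rewrite rpredZ // (contained_sub_tangent d_gt0 hF sLF) //.
by rewrite (subvP QL) ?memv_pick.
Qed.

End StarPoints.

(** * Star points on a line contained in the hypersurface *)

Section StarPointsOnLine.
Variables (K : numClosedFieldType) (N d : nat).
Variables (F : {mpoly K[N.+1]}) (L : {vspace 'rV[K]_N.+1}).
Hypotheses (d_ge3 : (3 <= d)%N) (smF : smooth_hypersurface d F).
Hypotheses (dimL : is_line L) (sLF : contained_in L F).
Implicit Types P Q : projpt K N.

Let hF : F \is d.-homog. Proof. by case: smF => [[]]. Qed.
Let d_gt0 : (0 < d)%N. Proof. exact: leq_trans d_ge3. Qed.

Let hcoordL P : lies_on P L -> hcoord P \in L.
Proof. by move=> PL; rewrite (subvP PL) ?memv_pick. Qed.

(** Choose w outside T_P and a zero z on L of D_w F. Every v is a multiple of w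
    plus some u in T_P; if T_P were contained in T_Q then (D_u F)(z), a
    multiple of (D_u F)(q), would vanish, and X would be singular at z. *)
Lemma star_tangent_nsub P Q :
    star_point d F P -> lies_on P L -> lies_on Q L -> P != Q ->
  ~~ (tangent_hyperplane F P <= tangent_hyperplane F Q)%VS.
Proof.
move=> starP PL QL neqPQ; apply/negP => sTPQ.
have [w wP] : exists w, (polar w F).@[hcoord P 0] != 0.
  apply: smooth_polar smF (hcoord_neq0 P) _.
  exact: contained_eval d_gt0 hF sLF (hcoordL PL).
have dm1_gt0 : (0 < d.-1)%N by rewrite -ltnS prednK // ltnW.
have [[x y] /= xy0 wz] :=
  binary_form_zero (hcoord P) (hcoord Q) dm1_gt0 (polar_dhomog w hF).
set z := (x *: _ + _) in wz.
have z0 : z != 0.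
  apply: contraNneq xy0 => /(hcoord_free neqPQ)[-> ->].
  by rewrite eqxx.
have [v] : exists v, (polar v F).@[z 0] != 0.
  apply: smooth_polar smF z0 (contained_eval d_gt0 hF sLF _).
  by rewrite rpredD ?rpredZ ?hcoordL.
case/negP; pose c := (polar v F).@[hcoord P 0] / (polar w F).@[hcoord P 0].
have uP : v - c *: w \in tangent_hyperplane F P.
  rewrite mem_tangent -scaleNr polarD polarZ mevalD mevalZ mulNr.
  by rewrite divfK // subrr.
rewrite -[v](subrK (c *: w)) polarD polarZ mevalD mevalZ wz mulr0 addr0.
rewrite (polar_star_line _ _ d_gt0 hF sLF) // mulf_eq0.
by rewrite -(mem_tangent F Q) (subvP sTPQ) ?orbT.
Qed.

(** On L the forms D_v F with v in the span of v0 and v1 are combinations of x^m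
    and y^m. One that vanishes at p2 would have to be invariant under
    translation by p2, and no such combination is, since m >= 2. *)
Lemma third_star_point P0 P1 P2 :
    star_point d F P0 -> star_point d F P1 -> star_point d F P2 ->
    lies_on P0 L -> lies_on P1 L -> lies_on P2 L ->
    P0 != P1 -> P2 != P0 -> P2 != P1 -> False.
Proof.
move=> star0 star1 star2 P0L P1L P2L neq01 neq20 neq21.
have [a [b def_p2]] := line_hcoord dimL P0L P1L neq01 (hcoordL P2L).
have a0 : a != 0.
  apply: contraNneq (oner_neq0 K) => a0; apply/eqP.
  apply: (proj1 (hcoord_free (y := - b) neq21 _)).
  by rewrite def_p2 a0 scale0r add0r scale1r scaleNr subrr.
have b0 : b != 0.
  apply: contraNneq (oner_neq0 K) => b0; apply/eqP.
  apply: (proj1 (hcoord_free (y := - a) neq20 _)).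
  by rewrite def_p2 b0 scale0r addr0 scale1r scaleNr subrr.
have /subvPn[v0 v0T0 v0T1] := star_tangent_nsub star0 P0L P1L neq01.
have neq10 : P1 != P0 by rewrite eq_sym.
have /subvPn[v1 v1T1 v1T0] := star_tangent_nsub star1 P1L P0L neq10.
rewrite mem_tangent in v0T1; rewrite mem_tangent in v1T0.
set al := (polar v0 F).@[_] in v0T1; set be := (polar v1 F).@[_] in v1T0.
(* The coefficients are chosen so that D_v F vanishes at p2 = (a, b) in the
   coordinates (x, y) given by p0 and p1. *)
pose m := d.-1; pose v := (a ^+ m * be) *: v0 - (b ^+ m * al) *: v1.
have polar_v x y : (polar v F).@[(x *: hcoord P0 + y *: hcoord P1) 0]
    = al * be * (a ^+ m * y ^+ m - b ^+ m * x ^+ m).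
  rewrite /v -scaleNr polarD !polarZ mevalD !mevalZ.
  rewrite (polar_star_line x y d_gt0 hF sLF star0) // -/al.
  rewrite (addrC (x *: _)) (polar_star_line y x d_gt0 hF sLF star1) // -/be -/m.
  by ring.
have vT2 : v \in tangent_hyperplane F P2.
  by rewrite mem_tangent def_p2 polar_v mulrC [b ^+ m * _]mulrC subrr mul0r.
have p1T2 : b *: hcoord P1 \in tangent_hyperplane F P2.
  by rewrite rpredZ // (contained_sub_tangent d_gt0 hF sLF) ?hcoordL.
(* Translating b p1 by exactly p2 turns the coordinates (0, b) into (a, 2 b),
   so that the powers of a and b cancel and only 2^m = 2 remains. *)
have := polar_star 1 hF star2 p1T2 vT2.
have -> : b *: hcoord P1 + 1 *: hcoord P2 =
          a *: hcoord P0 + (2 * b) *: hcoord P1.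
  by rewrite scale1r def_p2 addrCA -scalerDl mulrDl mul1r.
rewrite -[b *: hcoord P1]add0r -(scale0r (hcoord P0)) !polar_v.
have m_ge2 : (2 <= m)%N by rewrite /m -ltnS prednK.
move/(mulfI (mulf_neq0 v0T1 v1T0)).
rewrite [0 ^+ m]expr0n gtn_eqF ?(ltnW m_ge2) // mulr0 subr0 exprMn => eq2.
have : (2 ^+ m - 2) * (a ^+ m * b ^+ m) = 0.
  transitivity (a ^+ m * (2 ^+ m * b ^+ m) - b ^+ m * a ^+ m - a ^+ m * b ^+ m).
    by ring.
  by rewrite eq2 subrr.
move/eqP; rewrite !mulf_eq0 !expf_eq0 (negPf a0) (negPf b0) !andbF !orbF.
rewrite subr_eq0 -natrX eqr_nat gtn_eqF //.
by rewrite -{1}(expn1 2) ltn_exp2l.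
Qed.

End StarPointsOnLine.

Theorem proposition3p1 (R : realType) (N d : nat)
    (F : {mpoly (complex R)[N.+1]}) (L : {vspace 'rV[complex R]_N.+1}) :
  (2 <= N)%N -> (3 <= d)%N ->
  smooth_hypersurface d F ->
  is_line L -> contained_in L F ->
  forall s : seq (projpt (complex R) N),
    uniq s ->
    (forall P : projpt (complex R) N, P \in s -> lies_on P L /\ star_point d F P) ->
    (size s <= 2)%N.
Proof.
move=> _ d_ge3 smF dimL sLF [|P0 [|P1 [|P2 s]]] // uniq_s starL.
have [|L0 S0] := starL P0; first by rewrite !inE eqxx.
have [|L1 S1] := starL P1; first by rewrite !inE eqxx !orbT.
have [|L2 S2] := starL P2; first by rewrite !inE eqxx !orbT.
move: uniq_s; rewrite /= !inE !negb_or => /and3P[/and3P[n01 n02 _] /andP[n12 _] _].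
rewrite eq_sym in n02; rewrite eq_sym in n12.
by case: (third_star_point d_ge3 smF dimL sLF S0 S1 S2 L0 L1 L2 n01 n02 n12).
Qed.
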